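(* Let $m,n\geq1$ be integers, where $n$ is even, and let $F_{nm}$ denote the free group on generators $x_0,\dots,x_{nm-1}$. If $w$ is any word in $F_{nm}$ and $u=x_0x_{nm/2}$, then $G_{nm}(w,u)^{\mathrm{ab}}$ is finite if and only if $\mathrm{Res}(f_w(x),f_u(x))\neq0$, in which case $$|G_{nm}(w,u)^{\mathrm{ab}}|=|\mathrm{Res}(f_w(x),f_u(x))|=\prod_{\lambda^{nm/2}=-1}|f_w(\lambda)|.$$
   Context: For $r\ge1$ and words $w,v$ in the free group with basis $x_0,\dots,x_{r-1}$, let $\theta$ be the shift automorphism $\theta(x_i)=x_{i+1}$ (subscripts mod $r$). The bicyclically presented group $G_r(w,v)$ is $$G_r(w,v)=\langle x_0,\dots,x_{r-1}\mid w,\theta(w),\dots,\theta^{r-1}(w),\ v,\theta(v),\dots,\theta^{r-1}(v)\rangle.$$ $G^{\mathrm{ab}}$ denotes the abelianization of $G$. For a word $w$ in $x_0,\dots,x_{r-1}$ with exponent sum $a_i$ in $x_i$, the representer polynomial is $f_w(x)=\sum_{i=0}^{r-1}a_ix^i$; thus $f_u(x)=1+x^{nm/2}$. $\mathrm{Res}$ denotes the polynomial resultant; for $g$ monic, $|\mathrm{Res}(f,g)|=\prod_{g(\lambda)=0}|f(\lambda)|$ over the complex roots of $g$. *)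

(* Defs.v *)
From HB Require Import structures.
From mathcomp Require Import all_boot all_order all_algebra.
From mathcomp Require Import boolp classical_sets functions cardinality fsbigop.
From mathcomp Require Import reals complex.

Set Implicit Arguments.
Unset Strict Implicit.
Unset Printing Implicit Defensive.

Local Open Scope classical_set_scope.
Local Open Scope quotient_scope.

Definition is_subgroup (G : groupType) (H : set G) : Prop :=
  [/\ H 1%g, forall x y, H x -> H y -> H (x * y)%g
    & forall x, H x -> H (x^-1)%g].

Definition is_normal (G : groupType) (H : set G) : Prop :=
  is_subgroup H /\ forall x y, H x -> H (x ^ y)%g.

Record normal_subgroup (G : groupType) := NormalSubgroup {
  nsub_carrier :> G -> Prop;
  nsub_normal : is_normal nsub_carrier }.

Section QuotientGroup.
Variables (G : groupType) (N : normal_subgroup G).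
Implicit Types x y z : G.

Definition lcoset_rel : rel G := fun x y => `[< N (x^-1 * y)%g >].

Lemma lcoset_rel_equiv : equiv_class_of lcoset_rel.
Proof.
have [[N1 NM NV] _] := nsub_normal N.
split=> [x | x y | y x z]; rewrite /lcoset_rel.
- by apply/asboolP; rewrite mulVg.
- by apply/asbool_equiv_eq; split=> /NV; rewrite invgM invgK.
- move=> /asboolP Nxy /asboolP Nyz; apply/asboolP.
  by have := NM _ _ Nxy Nyz; rewrite mulgA mulgK.
Qed.

Canonical lcoset_equiv := EquivRelPack lcoset_rel_equiv.

Definition quotient_group := {eq_quot lcoset_equiv}.

HB.instance Definition _ := Choice.on quotient_group.
HB.instance Definition _ := EqQuotient.on quotient_group.

Definition quotient_map (x : G) : quotient_group := \pi x.

Lemma quotient_mapP x y :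
  quotient_map x = quotient_map y <-> N (x^-1 * y)%g.
Proof.
by split=> [/eqmodP /asboolP | Nxy]; last exact/eqmodP/asboolP.
Qed.

Definition quotient_mul (a b : quotient_group) :=
  quotient_map (repr a * repr b)%g.
Definition quotient_inv (a : quotient_group) := quotient_map (repr a)^-1%g.

Lemma repr_quotient_map x : N ((repr (quotient_map x))^-1 * x)%g.
Proof. by apply/quotient_mapP; rewrite /quotient_map reprK. Qed.

Lemma quotient_mulE x y :
  quotient_mul (quotient_map x) (quotient_map y) = quotient_map (x * y)%g.
Proof.
have [[N1 NM NV] NJ] := nsub_normal N.
apply/quotient_mapP; have := repr_quotient_map x; have := repr_quotient_map y.
move: (repr _) (repr _) => x' y' Ny Nx.
have := NM _ _ (NJ _ y' Nx) Ny.
by rewrite conjgE invgM !mulgA mulgK.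
Qed.

Lemma quotient_invE x : quotient_inv (quotient_map x) = quotient_map x^-1%g.
Proof.
have [[N1 NM NV] NJ] := nsub_normal N.
apply/quotient_mapP; have := repr_quotient_map x; move: (repr _) => x' Nx.
have := NV _ (NJ _ x'^-1%g Nx).
by rewrite conjgE !invgM !invgK !mulgA mulgK.
Qed.

Lemma quotient_mapW (P : quotient_group -> Prop) :
  (forall x, P (quotient_map x)) -> forall a, P a.
Proof. by move=> Pq; exact: quotW. Qed.

Lemma quotient_mulA : associative quotient_mul.
Proof.
elim/quotient_mapW=> x; elim/quotient_mapW=> y; elim/quotient_mapW=> z.
by rewrite !quotient_mulE mulgA.
Qed.
Lemma quotient_mul1 : left_id (quotient_map 1%g) quotient_mul.
Proof. by elim/quotient_mapW=> x; rewrite quotient_mulE mul1g. Qed.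
Lemma quotient_mulr1 : right_id (quotient_map 1%g) quotient_mul.
Proof. by elim/quotient_mapW=> x; rewrite quotient_mulE mulg1. Qed.
Lemma quotient_mulV :
  left_inverse (quotient_map 1%g) quotient_inv quotient_mul.
Proof.
by elim/quotient_mapW=> x; rewrite quotient_invE quotient_mulE mulVg.
Qed.
Lemma quotient_mulrV :
  right_inverse (quotient_map 1%g) quotient_inv quotient_mul.
Proof.
by elim/quotient_mapW=> x; rewrite quotient_invE quotient_mulE mulgV.
Qed.

HB.instance Definition _ := isGroup.Build quotient_group
  quotient_mulA quotient_mul1 quotient_mulr1 quotient_mulV quotient_mulrV.

End QuotientGroup.

Lemma smallest_normalP (G : groupType) (R : set G) :
  is_normal (smallest (@is_normal G) R).
Proof.
split; first split.
- by move=> H [[[N1 _ _] _] _]; exact: N1.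
- move=> x y Hx Hy H HP; have [[[_ HM _] _] _] := HP.
  by apply: HM; [apply: Hx | apply: Hy].
- by move=> x Hx H HP; have [[[_ _ HV] _] _] := HP; exact: HV (Hx _ HP).
- by move=> x y Hx H HP; have [[_ HJ] _] := HP; exact: HJ (Hx _ HP).
Qed.

Definition normal_closure (G : groupType) (R : set G) : normal_subgroup G :=
  NormalSubgroup (smallest_normalP R).

(* [~ x, y] = x^-1 * y^-1 * x * y *)
Definition commutators (G : groupType) : set G :=
  [set z | exists x y : G, z = [~ x, y]%g].

Definition derived_set (G : groupType) : set G :=
  smallest (@is_subgroup G) (@commutators G).

Lemma derived_set_normal (G : groupType) : is_normal (@derived_set G).
Proof.
have D_sub : is_subgroup (@derived_set G).
  split=> [H [[D1 _ _] _] | x y Dx Dy H HP | x Dx H HP].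
  - exact: D1.
  - have [[_ HM _] _] := HP.
    by apply: HM; [apply: Dx | apply: Dy].
  - by have [[_ _ HV] _] := HP; exact: HV (Dx _ HP).
split=> // x y Dx; have [_ DM _] := D_sub.
have -> : (x ^ y = x * [~ x, y])%g by rewrite commgEl mulVKg.
by apply: DM => // H [_]; apply; exists x, y.
Qed.

Definition derived_subgroup (G : groupType) : normal_subgroup G :=
  NormalSubgroup (@derived_set_normal G).

Definition abelianization (G : groupType) : groupType :=
  quotient_group (derived_subgroup G).

(* The letter (i, false) stands for x_i and (i, true) for its inverse. *)
Definition word (I : Type) := seq (I * bool).

Section FreeGroup.
Variable I : choiceType.
Implicit Types (s t : word I) (a : I * bool).

Definition inv_letter a := (a.1, ~~ a.2).
Definition inv_word s : word I := rev (map inv_letter s).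

Inductive free_eq : word I -> word I -> Prop :=
| FreeRefl s : free_eq s s
| FreeSym s t : free_eq s t -> free_eq t s
| FreeTrans s t u : free_eq s t -> free_eq t u -> free_eq s u
| FreeCancel s t a : free_eq (s ++ [:: a; inv_letter a] ++ t) (s ++ t).

Definition free_rel : rel (word I) := fun s t => `[< free_eq s t >].

Lemma free_rel_equiv : equiv_class_of free_rel.
Proof.
split=> [s | s t | t s u]; rewrite /free_rel.
- exact/asboolP/FreeRefl.
- by apply/asbool_equiv_eq; split; apply: FreeSym.
- by move=> /asboolP st /asboolP tu; apply/asboolP; apply: FreeTrans tu.
Qed.

Canonical free_equiv := EquivRelPack free_rel_equiv.

Definition free_group := {eq_quot free_equiv}.

HB.instance Definition _ := Choice.on free_group.
HB.instance Definition _ := EqQuotient.on free_group.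

Definition free_class s : free_group := \pi s.

Lemma free_classP s t : free_class s = free_class t <-> free_eq s t.
Proof. by split=> [/eqmodP /asboolP | st]; last exact/eqmodP/asboolP. Qed.

Lemma free_eq_cat s s' t t' :
  free_eq s s' -> free_eq t t' -> free_eq (s ++ t) (s' ++ t').
Proof.
move=> ss' tt'; apply: (@FreeTrans _ (s' ++ t)).
  elim: ss' => {s s'} [s | s s' _ | s s' s'' _ IH1 _ IH2 | s s' a].
  - exact: FreeRefl.
  - exact: FreeSym.
  - exact: FreeTrans IH2.
  - by rewrite -!catA; exact: FreeCancel.
elim: tt' => {t t'} [t | t t' _ | t t' t'' _ IH1 _ IH2 | t t' a].
- exact: FreeRefl.
- exact: FreeSym.
- exact: FreeTrans IH2.
- by rewrite !(catA s'); exact: FreeCancel.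
Qed.

Lemma inv_letterK : involutive inv_letter.
Proof. by case=> i b; rewrite /inv_letter /= negbK. Qed.

Lemma inv_wordK : involutive inv_word.
Proof. by move=> s; rewrite /inv_word map_rev revK (mapK inv_letterK). Qed.

Lemma inv_word_cat s t : inv_word (s ++ t) = inv_word t ++ inv_word s.
Proof. by rewrite /inv_word map_cat rev_cat. Qed.

Lemma free_eq_inv s t : free_eq s t -> free_eq (inv_word s) (inv_word t).
Proof.
elim=> {s t} [s | s t _ | s t u _ IH1 _ IH2 | s t a].
- exact: FreeRefl.
- exact: FreeSym.
- exact: FreeTrans IH2.
- have aV : inv_word [:: a; inv_letter a] = [:: a; inv_letter a].
    by rewrite /inv_word /rev /= inv_letterK.
  by rewrite !inv_word_cat aV -catA; exact: FreeCancel.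
Qed.

Lemma free_eq_mulV s : free_eq (s ++ inv_word s) [::].
Proof.
elim/last_ind: s => [|s a IH]; first exact: FreeRefl.
apply: FreeTrans IH; rewrite -cats1 inv_word_cat -catA.
exact: (FreeCancel s (inv_word s) a).
Qed.

Definition free_mul (x y : free_group) := free_class (repr x ++ repr y).
Definition free_inv (x : free_group) := free_class (inv_word (repr x)).

Lemma repr_free_class s : free_eq (repr (free_class s)) s.
Proof. by apply/free_classP; rewrite /free_class reprK. Qed.

Lemma free_mulE s t :
  free_mul (free_class s) (free_class t) = free_class (s ++ t).
Proof. by apply/free_classP/free_eq_cat; exact: repr_free_class. Qed.

Lemma free_invE s : free_inv (free_class s) = free_class (inv_word s).
Proof. by apply/free_classP/free_eq_inv; exact: repr_free_class. Qed.

Lemma free_classW (P : free_group -> Prop) :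
  (forall s, P (free_class s)) -> forall x, P x.
Proof. by move=> Pc; exact: quotW. Qed.

Lemma free_mulA : associative free_mul.
Proof.
elim/free_classW=> s; elim/free_classW=> t; elim/free_classW=> u.
by rewrite !free_mulE catA.
Qed.
Lemma free_mul1 : left_id (free_class [::]) free_mul.
Proof. by elim/free_classW=> s; rewrite free_mulE. Qed.
Lemma free_mulr1 : right_id (free_class [::]) free_mul.
Proof. by elim/free_classW=> s; rewrite free_mulE cats0. Qed.
Lemma free_mulrV : right_inverse (free_class [::]) free_inv free_mul.
Proof.
elim/free_classW=> s; rewrite free_invE free_mulE.
exact/free_classP/free_eq_mulV.
Qed.
Lemma free_mulV : left_inverse (free_class [::]) free_inv free_mul.
Proof.
elim/free_classW=> s; rewrite free_invE free_mulE -{2}(inv_wordK s).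
exact/free_classP/free_eq_mulV.
Qed.

HB.instance Definition _ := isGroup.Build free_group
  free_mulA free_mul1 free_mulr1 free_mulV free_mulrV.

End FreeGroup.

Definition presented_group (I : choiceType) (R : set (word I)) : groupType :=
  quotient_group (normal_closure (@free_class I @` R)).

(* theta, acting on words letter by letter; ordS i = i.+1 %% r *)
Definition shift (r : nat) (w : word 'I_r) : word 'I_r :=
  [seq (ordS a.1, a.2) | a <- w].

Definition bicyclic_relators (r : nat) (w v : word 'I_r) : set (word 'I_r) :=
  [set z | exists2 k : nat, (k < r)%N
         & z = iter k (@shift r) w \/ z = iter k (@shift r) v].

Definition bicyclic_group (r : nat) (w v : word 'I_r) : groupType :=
  presented_group (bicyclic_relators w v).

Definition exp_sum (r : nat) (w : word 'I_r) (i : 'I_r) : int :=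
  (\sum_(a <- w | a.1 == i) (-1) ^+ a.2)%R.

Definition representer (r : nat) (w : word 'I_r) : {poly int} :=
  (\sum_(i < r) (exp_sum w i)%:P * 'X^i)%R.

(* The subscript is read modulo r. *)
Definition gen (r : nat) (r_gt0 : (0 < r)%N) (i : nat) : 'I_r :=
  Ordinal (ltn_pmod i r_gt0).

Lemma mul_gt0 (m n : nat) : (0 < m -> 0 < n -> 0 < n * m)%N.
Proof. by move=> m_gt0 n_gt0; rewrite muln_gt0 n_gt0. Qed.

(* Main.v *)
(* The abelianization of G_r(w, v) is Z[x] / (f_w, f_v, x^r - 1), a word being
   sent to its representer polynomial. For v = u and r = n m, f_u = x^(r/2) + 1
   divides x^r - 1 and is monic, so this ring is the quotient of the polynomials
   of degree < deg f_w + deg f_u by the row lattice of the Sylvester matrix of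
   f_w and f_u. By the Smith normal form that quotient is finite exactly when
   the determinant, i.e. the resultant, is nonzero, and then has |Res| elements. *)

Require Import Defs.
From mathcomp Require Import all_boot all_order all_algebra.
From mathcomp Require Import boolp classical_sets functions cardinality fsbigop.
From mathcomp Require Import reals complex.
From mathcomp Require Import ring separable cyclotomic.

Set Implicit Arguments.
Unset Strict Implicit.
Unset Printing Implicit Defensive.

Import Order.TTheory GRing.Theory Num.Theory.
Local Open Scope classical_set_scope.
Local Open Scope ring_scope.

(** * Cardinality of the cokernel of a square integer matrix *)

Lemma card_eq_fintype (F : finType) (T : choiceType) (g : F -> T) :
  injective g -> (forall t, exists x, g x = t) -> ([set: T] #= `I_#|F|)%card.
Proof.
move=> g_inj g_surj; have -> : [set: T] = g @` [set: F].
  by apply/seteqP; split=> // t _; have [x <-] := g_surj t; exists x.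
apply: (card_eq_trans (inj_card_eq (in2W g_inj))).
have -> : [set: F] = enum_val @` [set: 'I_#|F|].
  apply/seteqP; split=> // x _; exists (enum_rank x) => //.
  exact: enum_rankK.
apply: (card_eq_trans (inj_card_eq (in2W enum_val_inj))).
by rewrite card_eq_sym card_II.
Qed.

Section Cokernel.
Variables (k : nat) (T : choiceType).

(** [c] identifies [T], as a set, with the quotient of Z^k by the lattice spanned by the rows of
    [A]. *)
Definition presents_coker (A : 'M[int]_k) (c : 'rV[int]_k -> T) :=
  (forall t, exists u, c u = t) /\
  (forall u v, c u = c v <-> exists w, u - v = w *m A).

(** The quotient is the product of the Z/d_i: a zero d_i contributes a copy of Z, and otherwise
    tuples of remainders form a system of representatives. *)
Lemma card_coker_diag (d : 'rV[int]_k) c : presents_coker (diag_mx d) c ->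
  (finite_set [set: T] -> \det (diag_mx d) != 0) /\
  (\det (diag_mx d) != 0 -> ([set: T] #= `I_(`|\det (diag_mx d)|%N))%card).
Proof.
move=> [c_surj c_eq]; rewrite det_diag.
have c_eqP u v : c u = c v <-> forall i, (d 0%R i %| (u - v)%R 0%R i)%Z.
  rewrite c_eq; split=> [[w uv] i | dvd_d].
    rewrite uv mul_mx_diag !mxE.
    by rewrite dvdz_mull.
  exists (\row_i ((u - v)%R 0%R i %/ d 0%R i)%Z).
  by apply/rowP=> i; rewrite mul_mx_diag [RHS]mxE [in RHS]mxE divzK.
split=> [T_fin | d_neq0].
  apply/prodf_neq0 => i _; apply/eqP => di0; apply: infinite_nat.
  (* When d_i = 0, the multiples n e_i lie in pairwise distinct classes. *)
  pose h (n : nat) := c (\row_j (n%:Z *+ (j == i))).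
  have h_inj : injective h.
    move=> n1 n2 /c_eqP /(_ i); rewrite di0 dvd0z !mxE eqxx subr_eq0.
    by move=> /eqP [].
  exact: (finite_preimage (in2W h_inj) T_fin).
have d_gt0 i : (0 < `|d 0%R i|)%N.
  by rewrite absz_gt0; have /prodf_neq0/(_ i isT) := d_neq0.
pose g (f : {dffun forall i, 'I_`|d 0%R i|}) := c (\row_i (f i : nat)%:Z).
have -> : `|(\prod_i d 0 i)%R|%N = #|{dffun forall i, 'I_`|d 0%R i|}|.
  rewrite card_dep_ffun foldrE big_image /= (big_morph _ abszM absz1).
  by apply: eq_bigr => i _; rewrite card_ord.
apply: (@card_eq_fintype _ _ g) => [f1 f2 /c_eqP eq_f | t].
  apply/ffunP => i; apply: val_inj => /=; have := eq_f i.
  rewrite !mxE -eqz_mod_dvd.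
  rewrite -!(modz_abs _ (d 0 i)) !modz_nat !modn_small // => /eqP[].
  by [].
have [u <-] := c_surj t.
have lt_f i : (`|(u 0%R i %% d 0%R i)%Z| < `|d 0%R i|)%N.
  rewrite -ltz_nat gez0_abs ?modz_ge0 ?ltz_mod // -absz_gt0 //.
exists [ffun i => Ordinal (lt_f i)]; apply/c_eqP => i.
rewrite !mxE ffunE /= gez0_abs ?modz_ge0 -?absz_gt0 //.
by rewrite -eqz_mod_dvd modz_mod.
Qed.

(** In the Smith form A = L D R, right multiplication by the unimodular [R] carries the cokernel of
    [D] onto that of [A], and the determinants of [L] and [R] have absolute value 1. *)
Lemma card_coker (A : 'M[int]_k) c : presents_coker A c ->
  (finite_set [set: T] <-> \det A != 0) /\
  (\det A != 0 -> ([set: T] #= `I_(`|\det A|%N))%card).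
Proof.
move=> [c_surj c_eq].
have [L L_unit [R R_unit [d _ A_eq]]] := int_Smith_normal_form A.
pose D := diag_mx (\row_(i < k) d`_i).
have {}A_eq : A = L *m D *m R.
  rewrite A_eq; congr (_ *m _ *m _); apply/matrixP=> i j; rewrite !mxE.
  by rewrite -val_eqE; case: eqP => // ->.
have D_c : presents_coker D (fun u => c (u *m R)).
  split=> [t | u v].
    by have [u <-] := c_surj t; exists (u *m invmx R); rewrite mulmxKV.
  rewrite c_eq A_eq -mulmxBl; split=> -[x].
    rewrite mulmxA => /(can_inj (mulmxK R_unit)) ->.
    by exists (x *m L); rewrite !mulmxA.
  by move=> ->; exists (x *m invmx L); rewrite !mulmxA mulmxKV.
have abs_unit (B : 'M[int]_k) : B \in unitmx -> `|\det B|%N = 1%N.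
  rewrite unitmxE => /unitrP[y [/(congr1 absz) + _]].
  by rewrite abszM absz1 => /eqP; rewrite muln_eq1 => /andP[_ /eqP].
have abs_det : `|\det A|%N = `|\det D|%N.
  by rewrite A_eq !det_mulmx !abszM (abs_unit L) // (abs_unit R) // mul1n muln1.
have det_neq0 : (\det A != 0) = (\det D != 0).
  by rewrite -!absz_gt0 abs_det.
have [fin_neq0 neq0_card] := card_coker_diag D_c.
rewrite abs_det det_neq0; split=> //; split=> // /neq0_card.
by move=> card_T; apply/finite_setP; exists `|\det D|%N.
Qed.
End Cokernel.

(** * Sylvester matrices, ideals and resultants *)

(** A combination of rows of the Sylvester matrix is a p + b q with deg a < deg q and deg b < deg p.
    Division by the monic [q] brings any combination of degree below deg p + deg q to this shape. *)
Lemma Sylvester_mx_ideal (R : comNzRingType) (p q : {poly R}) u :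
    q \is monic ->
  (exists a b, rVpoly u = a * p + b * q) <->
  (exists v, u = v *m Sylvester_mx p q).
Proof.
move=> q_monic; rewrite /Sylvester_mx.
have sz_q : (size q).-1.+1 = size q.
  by rewrite prednK // size_poly_gt0 monic_neq0.
have le_p (a : 'rV_(size q).-1) :
    (size (rVpoly a * p)%R <= (size q).-1 + (size p).-1)%N.
  have [->|p_neq0] := eqVneq p 0; first by rewrite mulr0 size_poly0.
  apply: leq_trans (size_polyMleq _ _) _.
  rewrite -(prednK (_ : 0 < size p)%N) ?size_poly_gt0 // addnS /=.
  by rewrite leq_add2r size_poly.
have le_q (b : 'rV_(size p).-1) :
    (size (rVpoly b * q)%R <= (size q).-1 + (size p).-1)%N.
  apply: leq_trans (size_polyMleq _ _) _.
  by rewrite -sz_q addnS /= addnC leq_add2l size_poly.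
split=> [[a [b u_eq]] | [v ->]]; last first.
  exists (rVpoly (lsubmx v)), (rVpoly (rsubmx v)).
  rewrite -[v in LHS]hsubmxK mul_row_col !mul_rV_lin1 /= -linearD /=.
  by rewrite poly_rV_K // (leq_trans (size_polyD _ _)) // geq_max !(le_p, le_q).
(* The quotient of [a] by [q] is moved into the cofactor of [q]; the bound on [b'] is then forced by
   those on [u] and [a' * p]. *)
pose a' := Pdiv.Ring.rmodp a q; pose b' := b + Pdiv.Ring.rdivp a q * p.
have a'_size : (size a' <= (size q).-1)%N.
  by rewrite -ltnS sz_q Pdiv.Ring.ltn_rmodpN0 ?monic_neq0.
have {}u_eq : rVpoly u = a' * p + b' * q.
  rewrite u_eq {1}(Pdiv.RingMonic.rdivp_eq q_monic a) /a' /b'; ring.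
have b'_size : (size b' <= (size p).-1)%N.
  have [->|b'_neq0] := eqVneq b' 0; first by rewrite size_poly0.
  have : (size (b' * q)%R <= (size q).-1 + (size p).-1)%N.
    have -> : b' * q = rVpoly u - a' * p by rewrite u_eq addrAC subrr add0r.
    rewrite (leq_trans (size_polyD _ _)) // geq_max size_poly size_polyN.
    by rewrite -(poly_rV_K a'_size) le_p.
  by rewrite size_Mmonic // -[in X in (X <= _)%N]sz_q addnS /= addnC leq_add2l.
exists (row_mx (poly_rV a') (poly_rV b')).
rewrite mul_row_col !mul_rV_lin1 /= !poly_rV_K // -linearD /= -u_eq.
by rewrite rVpolyK.
Qed.

Lemma mulmx_Vandermonde (R : comNzRingType) k d (u : 'rV[R]_k) (a : 'rV_d) j :
  (u *m Vandermonde k a) 0 j = (rVpoly u).[a 0 j].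
Proof.
rewrite mxE (horner_coef_wide _ (size_poly _ _)).
by apply: eq_bigr => i _; rewrite coef_rVpoly_ord mxE.
Qed.

(* [map_resultant] of the library only covers morphisms from {poly R}. *)
Lemma resultant_map_poly (aR rR : comNzRingType) (f : {rmorphism aR -> rR}) p q :
    f (lead_coef p) != 0 -> f (lead_coef q) != 0 ->
  resultant (map_poly f p) (map_poly f q) = f (resultant p q).
Proof.
move=> nz_fp nz_fq; rewrite /resultant -det_map_mx.
have sz_p : size (map_poly f p) = size p by apply: size_map_poly_id0.
have sz_q : size (map_poly f q) = size q by apply: size_map_poly_id0.
rewrite /Sylvester_mx sz_p sz_q map_col_mx; congr (\det (col_mx _ _)).
  apply/matrixP=> i j; rewrite !mxE /= !rVpoly_delta -coef_map rmorphM /=.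
  by rewrite map_polyXn.
apply/matrixP=> i j; rewrite !mxE /= !rVpoly_delta -coef_map rmorphM /=.
by rewrite map_polyXn.
Qed.

(* Multiply the Sylvester matrix by [V | 0; 1], where V evaluates at the
   roots of q: the rows coming from q vanish on V, those from p get scaled. *)
Lemma resultant_prod_XsubC (F : fieldType) (p : {poly F}) (s : seq F) :
  uniq s ->
  resultant p (\prod_(z <- s) ('X - z%:P)) = \prod_(z <- s) p.[z].
Proof.
move=> s_uniq; set q := \prod_(z <- s) _.
have q_monic : q \is monic by apply: monic_prod_XsubC.
have sz_q : (size q).-1 = size s by rewrite size_prod_XsubC.
pose d := (size q).-1; pose e := (size p).-1.
pose a : 'rV[F]_d := \row_j s`_j.
have q_a j : q.[a 0 j] = 0.
  by apply/eqP; rewrite -/(root _ _) root_prod_XsubC mxE mem_nth // -sz_q.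
pose V := Vandermonde d a.
(* A horizontal block of the Sylvester matrix: row i holds the coefficients of X^i r. *)
pose band (r : {poly F}) k := lin1_mx (@poly_rV F (d + e) \o r \o* @rVpoly F k).
have bandE r k (i : 'I_k) : (size ('X^i * r)%R <= d + e)%N ->
    rVpoly (row i (band r k)) = 'X^i * r.
  by move=> le_r; rewrite rowE mul_rV_lin1 /= rVpoly_delta poly_rV_K.
have le_size (r : {poly F}) (i k l : nat) : (i < k -> (size r).-1 = l ->
    size ('X^i * r)%R <= k + l)%N.
  move=> lt_ik <-; have [->|r_neq0] := eqVneq r 0.
    by rewrite mulr0 size_poly0.
  rewrite mulrC size_mulXn // -(prednK (_ : 0 < size r)%N) ?size_poly_gt0 //.
  by rewrite addnS -addSn leq_add2r.
have band_eval r k (i : 'I_k) j : (size ('X^i * r)%R <= d + e)%N ->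
    (band r k *m Vandermonde (d + e) a) i j = a 0 j ^+ i * r.[a 0 j].
  move=> le_r; transitivity ((row i (band r k) *m Vandermonde (d + e) a) 0 j).
    by rewrite -row_mul [RHS]mxE.
  by rewrite mulmx_Vandermonde bandE // hornerM hornerXn.
pose V' : 'M_(e, d) := dsubmx (Vandermonde (d + e) a).
have W_eq : row_mx (Vandermonde (d + e) a) (col_mx 0 1%:M) =
    block_mx V 0 V' (1%:M : 'M_e).
  rewrite block_mxEh -[Vandermonde _ a]vsubmxK; congr (row_mx (col_mx _ _) _).
  by apply/matrixP=> i j; rewrite !mxE.
(* The roots are distinct, so [\det V] can be cancelled at the end. *)
have V_neq0 : \det V != 0.
  rewrite det_Vandermonde; apply/prodf_neq0=> i _; apply/prodf_neq0=> j lt_ij.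
  rewrite subr_eq0 !mxE nth_uniq -?sz_q //.
  by rewrite neq_ltn lt_ij orbT.
have := erefl (\det (Sylvester_mx p q *m block_mx V 0 V' 1%:M)).
rewrite {2}det_mulmx det_lblock det1 mulr1 -/(resultant p q) -W_eq.
rewrite mul_col_row -/(band p d) -/(band q e).
have -> : band p d *m Vandermonde (d + e) a = V *m diag_mx (\row_j p.[a 0 j]).
  apply/matrixP=> i j; rewrite band_eval ?le_size //.
  by rewrite mul_mx_diag !mxE.
have -> : band q e *m Vandermonde (d + e) a = 0.
  apply/matrixP=> i j; rewrite band_eval ?[(d + e)%N]addnC ?le_size //.
  by rewrite q_a mulr0 mxE.
rewrite det_ublock det_mulmx det_diag => /esym.
have q_e i j : (band q e *m col_mx 0 1%:M) i j = ('X^i * q)`_(d + j).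
  rewrite -[band q e]hsubmxK mul_row_col mulmx0 add0r mulmx1 mxE.
  transitivity ((row i (band q e)) 0 (rshift d j)); first by rewrite [RHS]mxE.
  by rewrite -coef_rVpoly_ord bandE // addnC le_size.
(* The remaining block has entry q_(d+j-i) at (i, j). Since d = deg q, it is lower triangular, with
   the leading coefficient 1 on the diagonal. *)
rewrite [\det (_ *m col_mx _ _)]det_trig; last first.
  apply/is_trig_mxP=> i j lt_ij; rewrite q_e coefXnM ltnNge.
  rewrite (leq_trans (ltnW lt_ij)) ?leq_addl //= nth_default //.
  rewrite -addnBA ?(ltnW lt_ij) // -[size q]prednK ?size_poly_gt0 ?monic_neq0 //.
  by rewrite -[X in (X < _)%N]addn0 ltn_add2l subn_gt0.
rewrite [\prod_i (_ *m _) _ _]big1 ?mulr1 => [|i _]; last first.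
  rewrite q_e coefXnM ltnNge leq_addl /= addnK.
  exact: (monicP q_monic).
rewrite mulrC => /(mulfI V_neq0) ->.
rewrite (big_nth 0) big_mkord -sz_q; apply: eq_bigr => i _.
by rewrite !mxE.
Qed.

(** * Representer polynomials of words, modulo X^r - 1 *)

Section Representer.
Variable r : nat.
Implicit Types (s t : word 'I_r) (p : {poly int}).

Lemma representerE s :
  representer s = \sum_(a <- s) (-1) ^+ a.2 * 'X^(a.1).
Proof.
rewrite /representer /exp_sum.
under eq_bigr do rewrite rmorph_sum mulr_suml.
rewrite (exchange_big_dep xpredT) //=; apply: eq_bigr => a _.
rewrite (big_pred1 a.1) => [|i]; last by rewrite eq_sym.
by rewrite rmorphXn rmorphN1.
Qed.

Lemma representer_nil : representer ([::] : word 'I_r) = 0.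
Proof. by rewrite representerE big_nil. Qed.

Lemma representer1 a : representer [:: a] = (-1) ^+ a.2 * 'X^(a.1 : 'I_r).
Proof. by rewrite representerE big_seq1. Qed.

Lemma representer_cat s t :
  representer (s ++ t) = representer s + representer t.
Proof. by rewrite !representerE big_cat. Qed.

Lemma representer_inv s : representer (inv_word s) = - representer s.
Proof.
rewrite !representerE /inv_word (perm_big _ (permEl (perm_rev _))) /= big_map -sumrN.
by apply: eq_bigr => -[i b] _ /=; case: b; rewrite /= ?expr0 ?expr1; ring.
Qed.

Lemma representer_free_eq s t : free_eq s t -> representer s = representer t.
Proof.
elim=> {s t} // [s t u _ -> _ -> //|s t a].
rewrite !representer_cat -[[:: a; _]]/([:: a] ++ [:: inv_letter a]).
rewrite representer_cat -[[:: inv_letter a]]/(inv_word [:: a]).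
by rewrite representer_inv subrr add0r.
Qed.

Lemma coef_representer s (i : 'I_r) : (representer s)`_i = exp_sum s i.
Proof.
rewrite coef_sum (bigD1 i) //= big1 ?addr0.
  by rewrite coefCM coefXn eqxx mulr1.
move=> j ne_ji; rewrite coefCM coefXn eq_sym (inj_eq val_inj).
by rewrite (negPf ne_ji) mulr0.
Qed.

Lemma size_representer s : (size (representer s) <= r)%N.
Proof.
apply: (leq_trans (size_sum _ _ _)); apply/bigmax_leqP=> i _.
rewrite mul_polyC; apply: (leq_trans (size_scale_leq _ _)).
by rewrite size_polyXn.
Qed.

(** Equality in Z[x]/(x^r - 1), the ring in which shifting a word becomes multiplication by x. *)
Definition cyclic_congr p p' := exists c, p = p' + c * ('X^r - 1).

Lemma cyclic_congr_trans p2 p1 p3 :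
  cyclic_congr p1 p2 -> cyclic_congr p2 p3 -> cyclic_congr p1 p3.
Proof. by move=> [c ->] [c' ->]; exists (c' + c); ring. Qed.

Lemma cyclic_congrXn k : cyclic_congr 'X^k 'X^(k %% r).
Proof.
rewrite {1}(divn_eq k r) addnC exprD.
have [c ->] : cyclic_congr 'X^(k %/ r * r) 1.
  elim: (k %/ r)%N => [|l [c IH]]; first by exists 0; rewrite mul0r addr0.
  by exists (1 + 'X^r * c); rewrite mulSn exprD IH; ring.
by exists ('X^(k %% r) * c); ring.
Qed.

Lemma representer_shift s :
  cyclic_congr (representer (shift s)) ('X * representer s).
Proof.
rewrite !representerE /shift big_map.
elim: s => [|[i b] s [c IH]] /=; first by exists 0; rewrite !big_nil; ring.
rewrite !big_cons IH /=; have [c' c'E] := cyclic_congrXn i.+1.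
exists (c - (-1) ^+ b * c').
have -> : ('X^(i.+1 %% r) : {poly int}) = 'X * 'X^i - c' * ('X^r - 1).
  by rewrite -exprS c'E addrK.
by ring.
Qed.

Lemma representer_iter_shift k s :
  cyclic_congr (representer (iter k (@shift r) s)) ('X^k * representer s).
Proof.
elim: k => [|k [c IH]] /=; first by exists 0; ring.
apply: (cyclic_congr_trans (representer_shift _)); rewrite IH.
by exists ('X * c); rewrite exprS; ring.
Qed.

(** The relators list only the shifts by k < r, while multiplication by X^k calls for every k. *)
Lemma iter_shift_mod k s : iter k (@shift r) s = iter (k %% r) (@shift r) s.
Proof.
have iterE l : iter l (@shift r) s = [seq (iter l (@ordS r) a.1, a.2) | a <- s].
  elim: l => [|l IH] /=; first by rewrite map_id_in // => -[].
  by rewrite IH /shift -map_comp.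
have ordE l (i : 'I_r) : iter l (@ordS r) i = ((i + l) %% r)%N :> nat.
  elim: l => [|l IH]; first by rewrite addn0 modn_small.
  by rewrite /= IH -addn1 modnDml addn1 addnS.
rewrite !iterE; apply: eq_map => -[i b] /=; congr (_, _).
by apply: val_inj; rewrite /= !ordE modnDmr.
Qed.

(** Concatenation and inversion make the classes represented by words in [Q] an additive group; once
    it contains every X^k g, it contains all multiples of [g]. It serves with g = 1 to realize every
    polynomial, and with [g] the representer of a relator to realize its multiples by words trivial
    in the abelianization. *)
Lemma representer_lift (Q : word 'I_r -> Prop) g :
    Q [::] -> (forall s t, Q s -> Q t -> Q (s ++ t)) ->
    (forall s, Q s -> Q (inv_word s)) ->
    (forall k, exists2 s, Q s & cyclic_congr (representer s) ('X^k * g)) ->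
  forall p, exists2 s, Q s & cyclic_congr (representer s) (p * g).
Proof.
move=> Q0 QD QN QX p.
pose K p := exists2 s, Q s & cyclic_congr (representer s) p.
have K0 : K 0 by exists [::]; rewrite ?representer_nil //; exists 0; ring.
have KD p1 p2 : K p1 -> K p2 -> K (p1 + p2).
  move=> [s1 Q1 [c1 E1]] [s2 Q2 [c2 E2]]; exists (s1 ++ s2); first exact: QD.
  by exists (c1 + c2); rewrite representer_cat E1 E2; ring.
have KN p1 : K p1 -> K (- p1).
  move=> [s1 Q1 [c1 E1]]; exists (inv_word s1); first exact: QN.
  by exists (- c1); rewrite representer_inv E1; ring.
have KMn n p1 : K p1 -> K (p1 *+ n).
  by move=> Kp1; elim: n => [|n IH]; rewrite ?mulr0n // mulrS; apply: KD.
have KMz (z : int) p1 : K p1 -> K (p1 *~ z).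
  by case: z => n Kp1; [apply: KMn | apply/KN/KMn].
rewrite -[p]coefK poly_def mulr_suml.
apply: (big_ind K) => // i _.
by rewrite -scalerAl -[p`_i]intz scaler_int; apply: KMz.
Qed.

End Representer.

(** Otherwise every occurrence of the generator of [a] would carry the sign of [a], and its exponent
    sum could not vanish. *)
Lemma mem_inv_letter (r : nat) (a : 'I_r * bool) s :
  representer (a :: s) = 0 -> inv_letter a \in s.
Proof.
move=> f0; apply: contraT => inv_a_notin; have := coef_representer (a :: s) a.1.
rewrite f0 coef0 /exp_sum big_cons eqxx /= => /(congr1 ( *%R ((-1) ^+ a.2))).
rewrite mulr0 mulrDr -signr_addb addbb mulr_sumr => /eqP.
rewrite eq_sym gt_eqF // ltr_pwDl // big_seq_cond sumr_ge0 // => b.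
move=> /andP[b_in /eqP b1]; have -> : b.2 = a.2; last first.
  by rewrite -signr_addb addbb.
apply: contraNeq inv_a_notin => ne_ba; suff -> : inv_letter a = b by [].
by case: b a b1 ne_ba {b_in f0} => [i []] [j []] //= ->.
Qed.

(** * The abelianization as a quotient of Z[x] *)

Section BicyclicAbelianization.
Variables (r : nat) (r_gt0 : (0 < r)%N) (w v : word 'I_r).
Implicit Types (s t : word 'I_r) (p : {poly int}).
Local Notation G := (bicyclic_group w v).
Local Notation Gab := (abelianization G).

Definition class_G s : G :=
  quotient_map (normal_closure (@free_class _ @` bicyclic_relators w v))
    (free_class s).
Definition class_Gab s : Gab := quotient_map (derived_subgroup G) (class_G s).

Lemma free_class_cat s t :
  free_class (s ++ t) = (free_class s * free_class t)%g.
Proof. exact: esym (free_mulE s t). Qed.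

Lemma free_class_inv s : free_class (inv_word s) = (free_class s)^-1%g.
Proof. exact: esym (free_invE s). Qed.

Lemma class_G_cat s t : class_G (s ++ t) = (class_G s * class_G t)%g.
Proof.
by rewrite /class_G free_class_cat; exact: esym (quotient_mulE _ _ _).
Qed.

Lemma class_G_inv s : class_G (inv_word s) = (class_G s)^-1%g.
Proof. by rewrite /class_G free_class_inv; exact: esym (quotient_invE _ _). Qed.

Lemma class_Gab_cat s t : class_Gab (s ++ t) = (class_Gab s * class_Gab t)%g.
Proof.
by rewrite /class_Gab class_G_cat; exact: esym (quotient_mulE _ _ _).
Qed.

Lemma class_Gab_inv s : class_Gab (inv_word s) = (class_Gab s)^-1%g.
Proof. by rewrite /class_Gab class_G_inv; exact: esym (quotient_invE _ _). Qed.

Lemma class_Gab_nil : class_Gab [::] = 1%g.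
Proof. by []. Qed.

Lemma class_Gab_surj (x : Gab) : exists s, class_Gab s = x.
Proof.
elim/quotient_mapW: x => y; elim/quotient_mapW: y => z.
by elim/free_classW: z => s; exists s.
Qed.

Lemma class_GabC s t : class_Gab (s ++ t) = class_Gab (t ++ s).
Proof.
rewrite /class_Gab !class_G_cat; apply/quotient_mapP => H [_]; apply.
exists (class_G t), (class_G s).
by rewrite invgM commgEl conjgE !mulgA.
Qed.

(** Induction on length: the first letter has its inverse further on, commutativity brings the two
    together, and they cancel. *)
Lemma class_Gab_representer0 s : representer s = 0 -> class_Gab s = 1%g.
Proof.
have [n] := ubnP (size s); elim: n s => // n IH [|a s] //= le_n f0.
have a_in := mem_inv_letter f0; case/splitPr: a_in le_n f0 => s1 s2.
rewrite size_cat /= addnS => lt_n.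
have -> : class_Gab (a :: s1 ++ inv_letter a :: s2) = class_Gab (s1 ++ s2).
  (* [a] is moved past [s1], next to its inverse. *)
  rewrite -[a :: _]/(([:: a] ++ s1) ++ (inv_letter a :: s2)) class_Gab_cat.
  rewrite class_GabC -class_Gab_cat -catA.
  congr (quotient_map _ (quotient_map _ _)).
  exact/free_classP/FreeCancel.
rewrite -cat1s -[inv_letter a :: s2]cat1s !representer_cat => f0.
apply: IH; first by rewrite size_cat ltnW.
rewrite representer_cat -f0 -[[:: inv_letter a]]/(inv_word [:: a]).
by rewrite representer_inv; ring.
Qed.

(** Two words will have the same class in [Gab] exactly when their representers differ by an element
    of this ideal. *)
Definition bicyclic_ideal p :=
  exists a b c, p = a * representer w + b * representer v + c * ('X^r - 1).

Lemma bicyclic_ideal0 : bicyclic_ideal 0.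
Proof. by exists 0, 0, 0; ring. Qed.

Lemma bicyclic_idealD p1 p2 :
  bicyclic_ideal p1 -> bicyclic_ideal p2 -> bicyclic_ideal (p1 + p2).
Proof.
move=> [a [b [c ->]]] [a' [b' [c' ->]]].
by exists (a + a'), (b + b'), (c + c'); ring.
Qed.

Lemma bicyclic_idealN p : bicyclic_ideal p -> bicyclic_ideal (- p).
Proof. by move=> [a [b [c ->]]]; exists (- a), (- b), (- c); ring. Qed.

Lemma bicyclic_relators_ideal s :
  bicyclic_relators w v s -> bicyclic_ideal (representer s).
Proof.
move=> [k _ [] ->].
  have [c ->] := representer_iter_shift k w.
  by exists 'X^k, 0, c; ring.
have [c ->] := representer_iter_shift k v.
by exists 0, 'X^k, c; ring.
Qed.

(** The elements having such a word form a normal subgroup, since conjugation does not change the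
    representer, and this subgroup contains the relators. *)
Lemma normal_closure_ideal x :
    normal_closure (@free_class _ @` bicyclic_relators w v) x ->
  exists2 s, x = free_class s & bicyclic_ideal (representer s).
Proof.
move/(_ [set x | exists2 s, x = free_class s & bicyclic_ideal (representer s)]).
apply; split; last first.
  move=> _ [s /bicyclic_relators_ideal Js <-]; by exists s.
split; first split.
- by exists [::]; rewrite // representer_nil; exact: bicyclic_ideal0.
- move=> _ _ [s -> Js] [t -> Jt]; exists (s ++ t).
    by rewrite free_class_cat.
  by rewrite representer_cat; exact: bicyclic_idealD.
- move=> _ [s -> Js]; exists (inv_word s); first by rewrite free_class_inv.
  by rewrite representer_inv; exact: bicyclic_idealN.
move=> _ y [s -> Js]; elim/free_classW: y => t.
exists (inv_word t ++ s ++ t).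
  by rewrite !free_class_cat free_class_inv conjgE mulgA.
by rewrite !representer_cat representer_inv addrC addrK.
Qed.

(** The same argument with subgroups: a commutator has a word with representer 0. *)
Lemma derived_ideal x : derived_subgroup G x ->
  exists2 s, x = class_G s & bicyclic_ideal (representer s).
Proof.
move/(_ [set x | exists2 s, x = class_G s & bicyclic_ideal (representer s)]).
apply; split; last first.
  move=> _ [y [z ->]]; elim/quotient_mapW: y; elim/free_classW=> s.
  elim/quotient_mapW: z; elim/free_classW=> t.
  exists (inv_word s ++ inv_word t ++ s ++ t).
    by rewrite !class_G_cat !class_G_inv commgEl conjgE.
  rewrite !representer_cat !representer_inv [X in bicyclic_ideal X](_ : _ = 0).
    exact: bicyclic_ideal0.
  by ring.
split.
- by exists [::]; rewrite // representer_nil; exact: bicyclic_ideal0.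
- move=> _ _ [s -> Js] [t -> Jt]; exists (s ++ t).
    by rewrite class_G_cat.
  by rewrite representer_cat; exact: bicyclic_idealD.
- move=> _ [s -> Js]; exists (inv_word s); first by rewrite class_G_inv.
  by rewrite representer_inv; exact: bicyclic_idealN.
Qed.

(** Unwinding both quotients writes s^-1 t in the free group as z z', with [z] from the derived
    subgroup and [z'] from the normal closure; both representers lie in the ideal. *)
Lemma class_Gab_eq_ideal s t :
  class_Gab s = class_Gab t -> bicyclic_ideal (representer s - representer t).
Proof.
move=> /quotient_mapP /derived_ideal [z].
rewrite -class_G_inv -class_G_cat => /esym /quotient_mapP.
move=> /normal_closure_ideal [z']; rewrite -free_class_inv -free_class_cat.
move=> /free_classP /representer_free_eq.
rewrite !representer_cat !representer_inv => E Jz' Jz.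
have -> : representer s - representer t = - (representer z' + representer z).
  by rewrite -E; ring.
exact/bicyclic_idealN/bicyclic_idealD.
Qed.

Lemma representer_surj p : exists s, cyclic_congr r (representer s) p.
Proof.
have [|//|//|k|s _] := @representer_lift r (fun=> True) 1 _ _ _ _ p => //.
  exists [:: (gen r_gt0 k, false)] => //; rewrite representer1 expr0 mul1r mulr1.
  have [c ->] := cyclic_congrXn r k.
  by exists (- c); ring.
by rewrite mulr1; exists s.
Qed.

Lemma class_Gab_iter_shift z :
    (forall k, (k < r)%N -> bicyclic_relators w v (iter k (@shift r) z)) ->
  forall k, class_Gab (iter k (@shift r) z) = 1%g.
Proof.
move=> rel_z k; rewrite iter_shift_mod -class_Gab_nil; congr (quotient_map _ _).
apply/esym/quotient_mapP; rewrite invg1 mul1g => N [_]; apply.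
by eexists; first exact: rel_z (ltn_pmod k r_gt0).
Qed.

(** The multiples of f_w and f_v are realized modulo X^r - 1 by words [x] and [y] trivial in [Gab].
    Correcting by them leaves a word with representer 0. *)
Lemma ideal_class_Gab_eq s t :
  bicyclic_ideal (representer s - representer t) -> class_Gab s = class_Gab t.
Proof.
move=> [a [b [c E]]].
have lift z p : (forall k, class_Gab (iter k (@shift r) z) = 1%g) ->
    exists2 z', class_Gab z' = 1%g
      & cyclic_congr r (representer z') (p * representer z).
  move=> z1; apply: (@representer_lift r (fun z => class_Gab z = 1%g)) => //.
  - by move=> x y x1 y1; rewrite class_Gab_cat x1 y1 mulg1.
  - by move=> x x1; rewrite class_Gab_inv x1 invg1.
  by move=> k; eexists; [exact: z1 k | exact: representer_iter_shift].
have [|x x1 [cx Ex]] := lift w a.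
  by apply: class_Gab_iter_shift => k lt_k; exists k => //; left.
have [|y y1 [cy Ey]] := lift v b.
  by apply: class_Gab_iter_shift => k lt_k; exists k => //; right.
pose z := inv_word s ++ x ++ y ++ t.
have Ez : representer z = (cx + cy - c) * ('X^r - 1).
  rewrite !representer_cat representer_inv Ex Ey.
  transitivity (a * representer w + b * representer v
      - (representer s - representer t) + (cx + cy) * ('X^r - 1)); first by ring.
  by rewrite E; ring.
(* A representer has degree below r, so it vanishes once it is a multiple of the monic X^r - 1. *)
have z0 : representer z = 0.
  have := size_representer z; rewrite Ez.
  have [-> _|nz] := eqVneq (cx + cy - c) 0; first by rewrite mul0r.
  have Xr_monic : ('X^r - 1 : {poly int}) \is monic.
    by apply: monicXnsubC.
  rewrite size_Mmonic // size_XnsubC // addnS /= leqNgt.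
  by rewrite -[X in (X < _)%N]add0n ltn_add2r size_poly_gt0 nz.
have := class_Gab_representer0 z0.
rewrite !class_Gab_cat class_Gab_inv x1 y1 !mul1g => /(canRL (mulVKg _)).
by rewrite mulg1 => ->.
Qed.

End BicyclicAbelianization.

(** * The relator x_0 x_(r/2) for even r *)

Section HalfShiftRelator.
Variables (r : nat) (r_gt0 : (0 < r)%N) (r_even : ~~ odd r) (w : word 'I_r).
Let d := r./2.
Let u : word 'I_r := [:: (gen r_gt0 0, false); (gen r_gt0 d, false)].

Let d2 : (d + d = r)%N.
Proof. by rewrite addnn even_halfK. Qed.

Let d_gt0 : (0 < d)%N.
Proof. by rewrite -double_gt0 -addnn d2. Qed.

Lemma representer_half_shift : representer u = 'X^d - (- 1)%:P.
Proof.
rewrite representerE !big_cons big_nil /= !expr0 !mul1r mod0n expr0.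
rewrite modn_small; last by rewrite -[X in (_ < X)%N]d2 -addn1 leq_add2l.
by rewrite polyCN opprK addr0 addrC.
Qed.

Let u_monic : representer u \is monic.
Proof. by rewrite representer_half_shift monicXnsubC. Qed.

Let u_size : size (representer u) = d.+1.
Proof. by rewrite representer_half_shift size_XnsubC. Qed.

(** X^r - 1 = (X^d - 1)(X^d + 1) is a multiple of f_u, so the third generator is absorbed. *)
Lemma half_shift_ideal p : bicyclic_ideal w u p <->
  exists a b, p = a * representer w + b * representer u.
Proof.
split=> [[a [b [c ->]]] | [a [b ->]]]; last by exists a, b, 0; ring.
exists a, (b + c * ('X^d - 1)).
rewrite representer_half_shift polyCN polyC1 -[in 'X^r]d2 exprD.
by ring.
Qed.

(** A row vector is read as a polynomial and sent to the class of a chosen word representing it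
    modulo X^r - 1. The kernel is the ideal of f_w and f_u, cut out in these degrees by the
    Sylvester rows. *)
Lemma half_shift_coker : exists c : _ -> abelianization (bicyclic_group w u),
  presents_coker (Sylvester_mx (representer w) (representer u)) c.
Proof.
pose k := ((size (representer u)).-1 + (size (representer w)).-1)%N.
have [s sP] := choice (fun x : 'rV_k => representer_surj r_gt0 (rVpoly x)).
have s_rep x : bicyclic_ideal w u (representer (s x) - rVpoly x).
  by have [c ->] := sP x; exists 0, 0, c; ring.
exists (fun x => class_Gab w u (s x)); split=> [g | x y].
  have [t <-] := class_Gab_surj g.
  (* The remainder modulo the monic f_u has degree below d, so it fits in a row of length k. *)
  pose p := Pdiv.Ring.rmodp (representer t) (representer u).
  exists (poly_rV p); apply: (ideal_class_Gab_eq r_gt0).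
  have p_size : (size p <= k)%N.
    apply: leq_trans (leq_addr _ _); rewrite u_size -ltnS -u_size.
    by rewrite Pdiv.Ring.ltn_rmodpN0 ?monic_neq0.
  have := s_rep (poly_rV p); rewrite poly_rV_K // => Jp.
  pose b := Pdiv.Ring.rdivp (representer t) (representer u).
  have -> : representer (s (poly_rV p)) - representer t =
      representer (s (poly_rV p)) - p + - b * representer u.
    by rewrite {1}(Pdiv.RingMonic.rdivp_eq u_monic (representer t)) /b /p; ring.
  by apply: bicyclic_idealD => //; exists 0, (- b), 0; ring.
rewrite -(Sylvester_mx_ideal _ u_monic) linearB /= -half_shift_ideal.
split=> [/class_Gab_eq_ideal Jxy | Jxy]; last apply: (ideal_class_Gab_eq r_gt0).
  have -> : rVpoly x - rVpoly y = (representer (s x) - representer (s y))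
      + - (representer (s x) - rVpoly x) + (representer (s y) - rVpoly y) by ring.
  by do 2?apply: bicyclic_idealD => //; exact: bicyclic_idealN.
have -> : representer (s x) - representer (s y) = (rVpoly x - rVpoly y)
    + (representer (s x) - rVpoly x) + - (representer (s y) - rVpoly y) by ring.
by do 2?apply: bicyclic_idealD => //; exact: bicyclic_idealN.
Qed.

Lemma norm_resultant_half_shift (R : realType) :
    resultant (representer w) (representer u) != 0 ->
  `|resultant (representer w) (representer u)|%:~R =
    \big[*%R/1]_(z \in [set z : R[i] | z ^+ d = -1])
       `|(map_poly intr (representer w)).[z]|.
Proof.
move=> res_neq0; set C : numClosedFieldType := R[i].
(* If f_w = 0, its gcd with f_u is f_u, of positive degree d, and the resultant vanishes. Nonzero
   leading coefficients let the resultant commute with the passage to C. *)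
have w_neq0 : representer w != 0.
  apply: contraNneq res_neq0 => ->.
  by rewrite resultant_eq0 gcd0p u_size ltnS.
pose q : {poly C} := 'X^d - (- 1)%:P.
have q_monic : q \is monic by apply: monicXnsubC.
have q_eq : map_poly intr (representer u) = q.
  by rewrite representer_half_shift rmorphB /= map_polyXn map_polyC /= rmorphN1 /q polyCN polyC1.
have [s] := closed_field_poly_normal q; rewrite (monicP q_monic) scale1r => q_s.
(* The roots are simple because X^d + 1 divides X^r - 1, which is separable in characteristic 0. *)
have s_uniq : uniq s.
  rewrite -separable_prod_XsubC -q_s; apply: (@dvdp_separable _ ('X^r - 1)).
    apply/dvdpP; exists ('X^d - 1).
    by rewrite /q polyCN polyC1 -[in 'X^r]d2 exprD; ring.
  by apply: separable_Xn_sub_1; rewrite pnatr_eq0 -lt0n.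
(* Listing the roots turns the product over a set into a product over a duplicate-free sequence. *)
have -> : [set z : C | z ^+ d = -1] = [set` s].
  apply/seteqP; split=> z /=; rewrite -root_prod_XsubC -q_s /root !hornerE.
    by move=> ->; rewrite subrr.
  by rewrite subr_eq0 => /eqP.
rewrite -fsbig_seq // -normr_prod -resultant_prod_XsubC // -q_s -q_eq.
rewrite resultant_map_poly ?intr_norm //.
  by rewrite intr_eq0 lead_coef_eq0.
by rewrite (monicP u_monic) oner_eq0.
Qed.

End HalfShiftRelator.

(** * Specialization to r = nm with n even *)

Theorem theorem4p2 (R : realType) (m n : nat)
    (m_gt0 : (0 < m)%N) (n_gt0 : (0 < n)%N) (n_even : ~~ odd n)
    (w : word 'I_(n * m)) :
  let nm_gt0 := mul_gt0 m_gt0 n_gt0 in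
  let u := [:: (gen nm_gt0 0%N, false); (gen nm_gt0 (n * m)%N./2, false)] in
  let Gab := abelianization (bicyclic_group w u) in
  let res := resultant (representer w) (representer u) in
  (finite_set [set: Gab] <-> res != 0) /\
  (res != 0 ->
     ([set: Gab] #= `I_(`|res|%N))%card /\
     `|res|%:~R =
       \big[*%R/1]_(z \in [set z : R[i] | z ^+ (n * m)%N./2 = -1])
          `|(map_poly intr (representer w)).[z]|).
Proof.
move=> nm_gt0 u Gab res.
have nm_even : ~~ odd (n * m) by rewrite oddM negb_and n_even.
have [c c_coker] := half_shift_coker nm_gt0 nm_even w.
have [fin_iff card_eq] := card_coker c_coker.
split=> // res_neq0; split; first exact: card_eq.
by have := @norm_resultant_half_shift _ nm_gt0 nm_even w R res_neq0.
Qed.
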